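(* For $a\in\mathbb{R}$, the function $$x\mapsto \frac{a-\frac12\log(1-x)}{K(x)}$$ is strictly convex on $(0,1)$ if and only if $a\le\log 4$, and strictly concave on $(0,1)$ if and only if $a\ge 8/5$.
   Context: $K(x)={\cal K}(\sqrt x)=\frac\pi2\,{}_2F_1(1/2,1/2;1;x)$ for $x\in[0,1)$, where ${\cal K}(r)=\int_0^{\pi/2}(1-r^2\sin^2t)^{-1/2}dt$ is the complete elliptic integral of the first kind and ${}_2F_1$ is the Gauss hypergeometric function. *)

(* Defs.v *)
From Stdlib Require Import Reals.
From Coquelicot Require Import Coquelicot.
Open Scope R_scope.

(* K(x) = calK(sqrt x) = int_0^{pi/2} (1 - x sin^2 t)^{-1/2} dt, for x in [0,1). *)
Definition K (x : R) : R :=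
  RInt (fun t => / sqrt (1 - x * (sin t) ^ 2)) 0 (PI / 2).

Definition F (a : R) (x : R) : R := (a - / 2 * ln (1 - x)) / K x.

Definition strictly_convex_on (f : R -> R) (l u : R) : Prop :=
  forall x y t, l < x < u -> l < y < u -> x <> y -> 0 < t < 1 ->
    f (t * x + (1 - t) * y) < t * f x + (1 - t) * f y.

Definition strictly_concave_on (f : R -> R) (l u : R) : Prop :=
  forall x y t, l < x < u -> l < y < u -> x <> y -> 0 < t < 1 ->
    t * f x + (1 - t) * f y < f (t * x + (1 - t) * y).

(* Main.v *)
Require Import Defs.
From Stdlib Require Import Reals Lra Psatz.
From Coquelicot Require Import Coquelicot.
From Corelib Require Import ssreflect ssrbool.
Open Scope R_scope.

(** Put [Delta = sqrt (1 - x sin^2)], [D = int sin^2 / Delta], [B = int cos^2 / Delta]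
and [r = D / B], so that [K = B + D].  Contiguity relations express [B'] and [D']
through [B] and [D]; they give the Riccati equation
[r' = (1 - (1 - x) r^2) / (2 x (1 - x))] and show that [F''] is a positive multiple of
[threshold x - a], where [threshold] depends only on [x] and [r].  Thus [F] is strictly
convex (concave) exactly when [a] lies below (above) all values of [threshold] on (0,1).
By the Riccati equation, [threshold' < 0] reduces to
[(1 - x) (5 r^2 - 2 r - 1) < 2], and this region is invariant under the Riccati flow.
Hence [threshold] decreases from its limit [8/5] at 0 to its limit [log 4] at 1, the
latter by [K x = log 4 - log (1 - x) / 2 + o(1)]. *)

(** * Differentiation of weighted elliptic integrals under the integral sign *)

(** No lower bound is put on [x], so that the integrals below are defined on both sides of 0 and can
    be differentiated at 0. *)
Lemma radicand_pos x t : x < 1 -> 0 < 1 - x * (sin t) ^ 2.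
Proof.
  intros Hx. pose proof (sin2_cos2 t) as H. rewrite !Rsqr_pow2 in H.
  pose proof (pow2_ge_0 (sin t)). pose proof (pow2_ge_0 (cos t)).
  set (s := sin t ^ 2) in *. destruct (Rle_dec x 0); nra.
Qed.

(** A general weight lets one differentiation lemma serve both [cos^2] and [sin^2]; the weight 1
    gives the integrand of [K]. *)
Definition weighted_int (w : R -> R) (x : R) : R :=
  RInt (fun t => w t * / sqrt (1 - x * (sin t) ^ 2)) 0 (PI / 2).

Lemma continuity_2d_pt_snd_comp (h : R -> R) x t :
  continuous h t -> continuity_2d_pt (fun _ v => h v) x t.
Proof.
  intros Hh. apply continuity_pt_filterlim in Hh. apply (continuity_1d_2d_pt_comp h (fun _ v => v)); auto.
  apply continuity_2d_pt_id2.
Qed.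

Lemma continuity_2d_pt_radicand x t :
  continuity_2d_pt (fun u v => 1 - u * (sin v) ^ 2) x t.
Proof.
  apply continuity_2d_pt_minus. apply continuity_2d_pt_const.
  apply continuity_2d_pt_mult. apply continuity_2d_pt_id1.
  apply (continuity_2d_pt_snd_comp (fun v => (sin v) ^ 2)).
  apply (ex_derive_continuous (V := R_NormedModule)). auto_derive. trivial.
Qed.

Lemma continuity_2d_pt_sqrt_radicand x t : x < 1 ->
  continuity_2d_pt (fun u v => sqrt (1 - u * (sin v) ^ 2)) x t.
Proof.
  intros Hx. apply (continuity_1d_2d_pt_comp sqrt).
  - apply continuity_pt_sqrt. left. now apply radicand_pos.
  - apply continuity_2d_pt_radicand.
Qed.

Lemma weighted_int_integrand_continuous (w : R -> R) (w_cont : forall t, continuous w t) x t : x < 1 ->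
  continuous (fun t => w t * / sqrt (1 - x * (sin t) ^ 2)) t.
Proof.
  intros Hx. pose proof (radicand_pos x t Hx) as Hp.
  apply (continuous_mult w (fun t => / sqrt (1 - x * (sin t) ^ 2))); auto.
  apply (ex_derive_continuous (V := R_NormedModule)). auto_derive. split; [|split; [|trivial]].
  - simpl in *. lra.
  - apply Rgt_not_eq, sqrt_lt_R0. simpl in *. lra.
Qed.

Lemma weighted_int_ex (w : R -> R) (w_cont : forall t, continuous w t) x : x < 1 ->
  ex_RInt (fun t => w t * / sqrt (1 - x * (sin t) ^ 2)) 0 (PI / 2).
Proof.
  intros Hx. apply (ex_RInt_continuous (V := R_CompleteNormedModule)). intros t _. now apply weighted_int_integrand_continuous.
Qed.

Lemma weighted_int_integrand_derive (w : R -> R) x t : x < 1 ->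
  is_derive (fun u => w t * / sqrt (1 - u * (sin t) ^ 2)) x
    (w t * ((sin t) ^ 2 / (2 * sqrt (1 - x * (sin t) ^ 2) ^ 3))).
Proof.
  intros Hx. pose proof (radicand_pos x t Hx) as Hp.
  pose proof (sqrt_lt_R0 _ Hp).
  auto_derive.
  - simpl in *. repeat split; try lra. apply Rgt_not_eq. assumption.
  - change (sqrt (1 + - (x * (sin t * (sin t * 1))))) with (sqrt (1 - x * sin t ^ 2)).
    field. lra.
Qed.

Lemma weighted_int_derive (w : R -> R) (w_cont : forall t, continuous w t) x : x < 1 ->
  is_derive (weighted_int w) x
   (RInt (fun t => w t * ((sin t) ^ 2 / (2 * sqrt (1 - x * (sin t) ^ 2) ^ 3))) 0 (PI / 2)).
Proof.
  intros Hx.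
  assert (Hl : locally x (fun u => u < 1)) by (apply (open_lt 1); exact Hx).
  evar_last.
  { apply (is_derive_RInt_param (fun u t => w t * / sqrt (1 - u * (sin t) ^ 2))).
    - apply: filter_imp Hl => u Hu t _. eexists. now apply weighted_int_integrand_derive.
    - intros t _.
      (* The continuity condition concerns [Derive], which is known to agree with the explicit
         partial derivative only where [u < 1], hence locally. *)
      apply continuity_2d_pt_ext_loc with (f := fun u v => w v * ((sin v) ^ 2 * / (2 * sqrt (1 - u * (sin v) ^ 2) ^ 3))).
      + destruct Hl as [e He]. exists e. intros u v Hu _. symmetry. apply is_derive_unique.
        apply weighted_int_integrand_derive. apply He. exact Hu.
      + pose proof (sqrt_lt_R0 _ (radicand_pos x t Hx)) as Hs.
        apply continuity_2d_pt_mult.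
        { apply continuity_2d_pt_snd_comp, w_cont. }
        apply continuity_2d_pt_mult.
        { apply (continuity_2d_pt_snd_comp (fun v => (sin v) ^ 2)).
          apply (ex_derive_continuous (V := R_NormedModule)). auto_derive. trivial. }
        apply continuity_2d_pt_inv.
        * apply continuity_2d_pt_mult. apply continuity_2d_pt_const.
          simpl. repeat apply continuity_2d_pt_mult; try apply continuity_2d_pt_const;
          apply (continuity_2d_pt_sqrt_radicand x t Hx).
        * apply Rgt_not_eq. apply Rmult_lt_0_compat. lra. now apply pow_lt.
    - apply: filter_imp Hl => u Hu. now apply weighted_int_ex. }
  apply RInt_ext. intros t _. apply is_derive_unique. now apply weighted_int_integrand_derive.
Qed.

(** * The integrals B and D and their contiguity relations *)

(** The classical associated integrals of modulus [sqrt x]: with E the complete integral of the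
    second kind, [B = (E - (1 - x) K) / x] and [D = (K - E) / x]. *)
Definition ellB (x : R) := weighted_int (fun t => cos t ^ 2) x.
Definition ellD (x : R) := weighted_int (fun t => sin t ^ 2) x.

Lemma cos2_continuous t : continuous (fun t => cos t ^ 2) t.
Proof. apply (ex_derive_continuous (V := R_NormedModule)). auto_derive. trivial. Qed.

Lemma sin2_continuous t : continuous (fun t => sin t ^ 2) t.
Proof. apply (ex_derive_continuous (V := R_NormedModule)). auto_derive. trivial. Qed.

Lemma ellB_is_RInt x : x < 1 ->
  is_RInt (fun t => cos t ^ 2 * / sqrt (1 - x * (sin t) ^ 2)) 0 (PI / 2) (ellB x).
Proof. intros Hx. apply: RInt_correct. apply: weighted_int_ex => //. exact cos2_continuous. Qed.

Lemma ellD_is_RInt x : x < 1 ->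
  is_RInt (fun t => sin t ^ 2 * / sqrt (1 - x * (sin t) ^ 2)) 0 (PI / 2) (ellD x).
Proof. intros Hx. apply: RInt_correct. apply: weighted_int_ex => //. exact sin2_continuous. Qed.

Lemma K_ellBD x : x < 1 -> K x = ellB x + ellD x.
Proof.
  intros Hx. apply is_RInt_unique.
  apply: is_RInt_ext; [|apply (is_RInt_plus _ _ _ _ _ _ (ellB_is_RInt x Hx) (ellD_is_RInt x Hx))].
  intros t _. unfold plus; simpl. pose proof (sin2_cos2 t) as H. unfold Rsqr in H.
  rewrite -Rmult_plus_distr_r. replace (_ + _) with 1 by lra. now rewrite Rmult_1_l.
Qed.

(* The boundary term [sin t cos t / Delta] vanishes at both ends. *)
Lemma boundary_is_RInt x : x < 1 ->
  is_RInt (fun t => cos t ^ 2 / sqrt (1 - x * (sin t) ^ 2) ^ 3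
                    - sin t ^ 2 * / sqrt (1 - x * (sin t) ^ 2)) 0 (PI / 2) 0.
Proof.
  intros Hx.
  evar_last.
  { apply (is_RInt_derive (fun t => sin t * cos t / sqrt (1 - x * (sin t) ^ 2))).
    - intros t _. pose proof (radicand_pos x t Hx) as Hp. pose proof (sqrt_lt_R0 _ Hp).
      auto_derive.
      + simpl in *. repeat split; try lra. apply Rgt_not_eq. assumption.
      + change (sqrt (1 + - (x * (sin t * (sin t * 1))))) with (sqrt (1 - x * sin t ^ 2)).
        pose proof (sqrt_sqrt _ (Rlt_le _ _ Hp)) as Hq2.
        set (q := sqrt (1 - x * _)) in *.
        (* [field] does not know that [q^2 = 1 - x sin^2], so the difference of the two sides is
           written as a multiple of [q * q - (1 - x sin^2)]. The same device recurs below. *)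
        apply Rminus_diag_uniq.
        transitivity (cos t ^ 2 * (q * q - (1 - x * sin t ^ 2)) / q ^ 3); [field; lra|].
        rewrite Hq2. field. lra.
    - intros t _. pose proof (radicand_pos x t Hx) as Hp. pose proof (sqrt_lt_R0 _ Hp).
      apply (ex_derive_continuous (V := R_NormedModule)). auto_derive.
      simpl in *. repeat split; try lra; apply Rgt_not_eq; repeat apply Rmult_lt_0_compat; first [lra | assumption]. }
  unfold minus, plus, opp; simpl. rewrite cos_PI2 sin_0. unfold Rdiv. ring.
Qed.

(** Since [x sin^2 = 1 - Delta^2], the differentiated integrand is [(cos^2 / Delta^3 - cos^2 /
    Delta) / (2 x)]; adding multiples of the vanishing boundary integral trades [cos^2 / Delta^3]
    for [sin^2 / Delta]. The derivative of D is obtained in the same way. *)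
Lemma ellB_derive x : 0 < x < 1 -> is_derive ellB x ((ellD x - ellB x) / (2 * x)).
Proof.
  intros Hx. assert (Hx1 : x < 1) by lra.
  evar_last. { apply (weighted_int_derive _ cos2_continuous x Hx1). }
  apply is_RInt_unique.
  pose proof (is_RInt_scal _ _ _ (/ (2 * x)) _ (is_RInt_plus _ _ _ _ _ _
     (is_RInt_minus _ _ _ _ _ _ (ellD_is_RInt x Hx1) (ellB_is_RInt x Hx1)) (boundary_is_RInt x Hx1))) as H.
  evar_last. { apply: is_RInt_ext; [|apply H].
    intros t _. unfold scal, plus, minus, opp, mult; simpl; unfold mult, plus, opp; simpl.
    pose proof (radicand_pos x t Hx1) as Hp. pose proof (sqrt_lt_R0 _ Hp).
    pose proof (sqrt_sqrt _ (Rlt_le _ _ Hp)) as Hq2. simpl in *.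
    set (q := sqrt (1 - x * _)) in *.
    apply Rminus_diag_uniq.
    transitivity (- cos t ^ 2 * (q * q - (1 - x * (sin t * (sin t * 1)))) / (2 * x * q ^ 3)); [field; lra|].
    rewrite Hq2. field. lra. }
  unfold scal, plus, minus, opp, mult; simpl; unfold mult, plus, opp; simpl. field. lra.
Qed.

Lemma ellD_derive x : 0 < x < 1 ->
  is_derive ellD x ((ellB x - (1 - x) * ellD x) / (2 * x * (1 - x))).
Proof.
  intros Hx. assert (Hx1 : x < 1) by lra.
  evar_last. { apply (weighted_int_derive _ sin2_continuous x Hx1). }
  apply is_RInt_unique.
  pose proof (is_RInt_scal _ _ _ (/ (2 * x * (1 - x))) _ (is_RInt_minus _ _ _ _ _ _
     (is_RInt_minus _ _ _ _ _ _ (ellB_is_RInt x Hx1) (is_RInt_scal _ _ _ (1 - x) _ (ellD_is_RInt x Hx1))) (boundary_is_RInt x Hx1))) as H.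
  evar_last. { apply: is_RInt_ext; [|apply H].
    intros t _. unfold scal, plus, minus, opp, mult; simpl; unfold mult, plus, opp; simpl.
    pose proof (radicand_pos x t Hx1) as Hp. pose proof (sqrt_lt_R0 _ Hp).
    pose proof (sqrt_sqrt _ (Rlt_le _ _ Hp)) as Hq2. simpl in *.
    pose proof (sin2_cos2 t) as Ht. unfold Rsqr in Ht.
    set (q := sqrt (1 - x * _)) in *.
    apply Rminus_diag_uniq.
    replace (cos t * (cos t * 1)) with (1 - sin t * (sin t * 1)) by lra.
    transitivity ((1 - (1 - x) * sin t ^ 2) * (q * q - (1 - x * (sin t * (sin t * 1)))) / (2 * x * (1 - x) * q ^ 3)); [field; lra|].
    rewrite Hq2. field. lra. }
  unfold scal, plus, minus, opp, mult; simpl; unfold mult, plus, opp; simpl. field. lra.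
Qed.

Lemma weighted_int_pos w x : (forall t, continuous w t) -> (forall t, 0 < t < PI / 2 -> 0 < w t) ->
  x < 1 -> 0 < weighted_int w x.
Proof.
  intros Hc Hw Hx. apply RInt_gt_0.
  - pose proof PI_RGT_0. lra.
  - intros t Ht. apply Rmult_lt_0_compat. auto. apply Rinv_0_lt_compat, sqrt_lt_R0.
    now apply radicand_pos.
  - intros t _. now apply weighted_int_integrand_continuous.
Qed.

Lemma ellB_pos x : x < 1 -> 0 < ellB x.
Proof.
  intros Hx. apply weighted_int_pos; auto. exact cos2_continuous.
  intros t Ht. apply pow_lt, cos_gt_0; pose proof PI_RGT_0; lra.
Qed.

Lemma ellD_pos x : x < 1 -> 0 < ellD x.
Proof.
  intros Hx. apply weighted_int_pos; auto. exact sin2_continuous.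
  intros t Ht. apply pow_lt, sin_gt_0; pose proof PI_RGT_0; lra.
Qed.

(** At [x = 0], where [Delta = 1], the boundary identity says that [cos^2 - sin^2] has integral
    0. *)
Lemma B0_eq_D0 : ellB 0 = ellD 0.
Proof.
  assert (H0 : 0 < 1) by lra.
  pose proof (is_RInt_plus _ _ _ _ _ _ (boundary_is_RInt 0 H0) (ellD_is_RInt 0 H0)) as H.
  assert (H2 : is_RInt (fun t => cos t ^ 2 * / sqrt (1 - 0 * sin t ^ 2)) 0 (PI / 2) (plus 0 (ellD 0))).
  { apply: is_RInt_ext H. intros t _. unfold plus; simpl. rewrite !Rmult_0_l Rminus_0_r sqrt_1. field. }
  rewrite -(Rplus_0_l (ellD 0)). apply is_RInt_unique, H2.
Qed.

(** * Estimates of B and K as x tends to 1 *)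

(** Both bounds come from [Delta^2 = cos^2 + (1 - x) sin^2]. Thus [Delta] tends to [cos] uniformly
    at rate [sqrt (1 - x)]. *)
Lemma modulus_bounds x t : 0 < x < 1 -> 0 <= t <= PI / 2 ->
  cos t <= sqrt (1 - x * sin t ^ 2) <= cos t + sqrt (1 - x).
Proof.
  intros Hx Ht. pose proof PI_RGT_0.
  assert (Hc : 0 <= cos t) by (apply cos_ge_0; lra).
  pose proof (radicand_pos x t ltac:(lra)) as Hp.
  pose proof (sin2_cos2 t) as H1. rewrite !Rsqr_pow2 in H1.
  pose proof (pow2_ge_0 (sin t)). pose proof (pow2_ge_0 (cos t)).
  pose proof (sqrt_pos (1 - x)) as Hq.
  pose proof (pow2_sqrt (1 - x) ltac:(lra)) as Hq2.
  split.
  - rewrite -{1}(sqrt_pow2 (cos t)); auto. apply sqrt_le_1_alt. nra.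
  - rewrite -(sqrt_pow2 (cos t + sqrt (1 - x))); [|lra]. apply sqrt_le_1_alt. nra.
Qed.

Lemma cos_is_RInt : is_RInt cos 0 (PI / 2) 1.
Proof.
  evar_last. { apply (is_RInt_derive sin).
    - intros t _. auto_derive; trivial. ring.
    - intros t _. apply (ex_derive_continuous (V := R_NormedModule)). auto_derive. trivial. }
  unfold minus, plus, opp; simpl. rewrite sin_PI2 sin_0. ring.
Qed.

Lemma const_is_RInt (q : R) : is_RInt (fun _ : R => q) 0 (PI / 2) (PI / 2 * q).
Proof.
  evar_last. { apply (is_RInt_const 0 (PI / 2) q). }
  unfold scal; simpl; unfold mult; simpl. ring.
Qed.

Lemma cos_div_is_RInt : is_RInt (fun t => cos t / (1 + sin t)) 0 (PI / 2) (ln 2).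
Proof.
  pose proof PI_RGT_0 as Hpi.
  assert (Hs : forall t, Rmin 0 (PI / 2) <= t <= Rmax 0 (PI / 2) -> 0 < 1 + sin t).
  { intros t Ht. rewrite Rmin_left in Ht; [|lra]. rewrite Rmax_right in Ht; [|lra].
    pose proof (sin_ge_0 t ltac:(lra) ltac:(lra)). lra. }
  evar_last. { apply (is_RInt_derive (fun t => ln (1 + sin t))).
    - intros t Ht. specialize (Hs t Ht). auto_derive; trivial. field. lra.
    - intros t Ht. specialize (Hs t Ht).
      apply (ex_derive_continuous (V := R_NormedModule)). auto_derive. lra. }
  unfold minus, plus, opp; simpl. rewrite sin_PI2 sin_0 Rplus_0_r ln_1.
  replace (1 + 1) with 2 by ring. ring.
Qed.

(** This is [artanh k / k] with [k = sqrt x]; it carries the logarithmic singularity of [K] at 1. *)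
Definition log_part (x : R) := (ln (1 + sqrt x) - ln (sqrt (1 - x))) / sqrt x.

Lemma log_part_is_RInt x : 0 < x < 1 ->
  is_RInt (fun t => sin t / sqrt (1 - x * sin t ^ 2)) 0 (PI / 2) (log_part x).
Proof.
  intros Hx. pose proof PI_RGT_0 as Hpi.
  pose proof (sqrt_lt_R0 x ltac:(lra)) as Hk.
  evar_last. { apply (is_RInt_derive (fun t => - / sqrt x * ln (sqrt x * cos t + sqrt (1 - x * sin t ^ 2)))).
    - intros t Ht. rewrite Rmin_left in Ht; [|lra]. rewrite Rmax_right in Ht; [|lra].
      assert (Hc : 0 <= cos t) by (apply cos_ge_0; lra).
      pose proof (radicand_pos x t ltac:(lra)) as Hp. pose proof (sqrt_lt_R0 _ Hp) as Hq.
      auto_derive.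
      + change (sqrt (1 + - (x * (sin t * (sin t * 1))))) with (sqrt (1 - x * sin t ^ 2)).
        simpl in *. repeat split; try lra. nra.
      + change (sqrt (1 + - (x * (sin t * (sin t * 1))))) with (sqrt (1 - x * sin t ^ 2)).
        set (q := sqrt (1 - x * _)) in *.
        replace (x * _) with (sqrt x * sqrt x * (1 * cos t * (2 * sin t))).
        2:{ rewrite sqrt_sqrt; [|lra]. simpl. ring. }
        field. repeat split; try lra; nra.
    - intros t _. pose proof (radicand_pos x t ltac:(lra)) as Hp. pose proof (sqrt_lt_R0 _ Hp) as Hq.
      apply (ex_derive_continuous (V := R_NormedModule)). auto_derive.
      simpl in *. repeat split; try lra. apply Rgt_not_eq. exact Hq. }
  unfold minus, plus, opp; simpl. rewrite sin_PI2 sin_0 cos_PI2 cos_0.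
  replace (1 - x * (1 * (1 * 1))) with (1 - x) by ring.
  replace (1 - x * (0 * (0 * 1))) with 1 by ring. rewrite sqrt_1.
  unfold log_part. rewrite Rmult_0_r Rplus_0_l Rmult_1_r (Rplus_comm (sqrt x) 1). field. lra.
Qed.

Lemma is_RInt_le_PI2 (f g : R -> R) I1 I2 : is_RInt f 0 (PI / 2) I1 -> is_RInt g 0 (PI / 2) I2 ->
  (forall t, 0 <= t <= PI / 2 -> f t <= g t) -> I1 <= I2.
Proof.
  intros Hf Hg H. apply (is_RInt_le f g 0 (PI / 2)); auto.
  - pose proof PI_RGT_0. lra.
  - intros t Ht. apply H. lra.
Qed.

(** Integrate [cos - sqrt (1 - x) <= cos^2 / Delta <= cos]. *)
Lemma ellB_bounds x : 0 < x < 1 -> 1 - PI / 2 * sqrt (1 - x) <= ellB x <= 1.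
Proof.
  intros Hx. pose proof PI_RGT_0 as Hpi.
  pose proof (ellB_is_RInt x ltac:(lra)) as HB.
  pose proof (is_RInt_minus _ _ _ _ _ _ cos_is_RInt (const_is_RInt (sqrt (1 - x)))) as HL.
  split.
  - apply: is_RInt_le_PI2 HL HB _ => t Ht. unfold minus, plus, opp; simpl.
    pose proof (modulus_bounds x t Hx Ht) as [H1 H2].
    assert (Hc : 0 <= cos t) by (apply cos_ge_0; lra).
    pose proof (sqrt_lt_R0 _ (radicand_pos x t ltac:(lra))) as Hq. simpl in *.
    set (d := sqrt (1 - x * _)) in *.
    apply Rmult_le_reg_r with d; auto. rewrite Rmult_assoc Rinv_l; [|lra]. nra.
  - apply: is_RInt_le_PI2 HB cos_is_RInt _ => t Ht.
    pose proof (modulus_bounds x t Hx Ht) as [H1 H2].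
    assert (Hc : 0 <= cos t) by (apply cos_ge_0; lra).
    pose proof (sqrt_lt_R0 _ (radicand_pos x t ltac:(lra))) as Hq.
    set (d := sqrt (1 - x * _)) in *.
    apply Rmult_le_reg_r with d; auto. rewrite Rmult_assoc Rinv_l; [|lra]. nra.
Qed.

(* Split [1/Delta = sin/Delta + (1 - sin)/Delta]; the last term is
   [cos / (1 + sin)] up to [sqrt (1 - x)]. *)
Lemma K_bounds x : 0 < x < 1 ->
  log_part x + ln 2 - PI / 2 * sqrt (1 - x) <= K x <= log_part x + ln 2.
Proof.
  intros Hx. pose proof PI_RGT_0 as Hpi.
  assert (HK : is_RInt (fun t => / sqrt (1 - x * sin t ^ 2)) 0 (PI / 2) (K x)).
  { apply: RInt_correct. apply (ex_RInt_ext (fun t => 1 * / sqrt (1 - x * sin t ^ 2))).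
    - intros t _. apply Rmult_1_l.
    - apply (weighted_int_ex (fun _ => 1)); [|lra]. intros t. apply continuous_const. }
  pose proof (is_RInt_plus _ _ _ _ _ _ (log_part_is_RInt x Hx) cos_div_is_RInt) as HU.
  pose proof (is_RInt_minus _ _ _ _ _ _ HU (const_is_RInt (sqrt (1 - x)))) as HL.
  assert (P : forall t, 0 <= t <= PI / 2 ->
     sin t / sqrt (1 - x * sin t ^ 2) + cos t / (1 + sin t) - sqrt (1 - x) <= / sqrt (1 - x * sin t ^ 2)
     <= sin t / sqrt (1 - x * sin t ^ 2) + cos t / (1 + sin t)).
  { intros t Ht.
    pose proof (modulus_bounds x t Hx Ht) as [H1 H2].
    assert (Hc : 0 <= cos t) by (apply cos_ge_0; lra).
    assert (Hs : 0 <= sin t) by (apply sin_ge_0; lra).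
    pose proof (sqrt_lt_R0 _ (radicand_pos x t ltac:(lra))) as Hq.
    pose proof (sqrt_pos (1 - x)).
    pose proof (sin2_cos2 t) as Ht2. unfold Rsqr in Ht2.
    set (d := sqrt (1 - x * _)) in *. set (q := sqrt (1 - x)) in *.
    (* By [(1 - sin) (1 + sin) = cos^2] the error has this exact form; it lies in [0, q] because
       [0 <= d - cos <= q] and [cos <= d]. *)
    assert (E : sin t / d + cos t / (1 + sin t) - / d = cos t * (d - cos t) / (d * (1 + sin t))).
    { apply Rminus_diag_uniq.
      transitivity ((sin t * sin t + cos t * cos t - 1) / (d * (1 + sin t))); [field; lra|].
      rewrite Ht2. unfold Rdiv. ring. }
    assert (0 < d * (1 + sin t)) by (apply Rmult_lt_0_compat; lra).
    assert (0 <= cos t * (d - cos t) / (d * (1 + sin t)) <= q); [|lra].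
    split.
    - apply Rmult_le_pos. apply Rmult_le_pos; lra. apply Rlt_le, Rinv_0_lt_compat; auto.
    - apply Rmult_le_reg_r with (d * (1 + sin t)); auto. unfold Rdiv. rewrite Rmult_assoc Rinv_l; [|lra].
      assert (cos t * (d - cos t) <= d * q) by nra.
      assert (0 <= d * q) by (apply Rmult_le_pos; lra). nra. }
  split.
  - apply: is_RInt_le_PI2 HL HK _ => t Ht. apply P, Ht.
  - apply: is_RInt_le_PI2 HK HU _ => t Ht. apply P, Ht.
Qed.

(** * The Riccati equation for D / B and its barriers *)

(* At a minimum of [Z] on [[0, x]] with nonpositive value, the positive
   derivative would produce smaller values to the left. *)
Lemma pos_of_derive_pos_when_nonpos (Z Z' : R -> R) :
  (forall x, 0 <= x < 1 -> continuous Z x) -> Z 0 = 0 ->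
  (forall x, 0 < x < 1 -> is_derive Z x (Z' x)) ->
  (forall x, 0 < x < 1 -> Z x <= 0 -> 0 < Z' x) ->
  forall x, 0 < x < 1 -> 0 < Z x.
Proof.
  intros Hc H0 Hd Hpos x Hx. apply Rnot_le_lt. intros Hneg.
  assert (Hmin : exists c, 0 < c <= x /\ Z c <= 0 /\ forall z, 0 <= z <= x -> Z c <= Z z).
  { destruct (continuity_ab_min Z 0 x) as [m [Hm1 Hm2]]; [lra| |].
    - intros c Hc1. apply continuity_pt_filterlim. apply Hc. lra.
    - pose proof (Hm1 x ltac:(lra)). destruct (Req_dec m 0) as [->|Hm0].
      (* If the minimum is at 0, its value is 0, so [Z x <= 0] makes [x] a minimum too. *)
      + exists x. split; [lra|split; [lra|]]. intros z Hz. specialize (Hm1 z Hz). lra.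
      + exists m. repeat split; try lra. exact Hm1. }
  destruct Hmin as [c [Hc1 [Hc2 Hc3]]].
  pose proof (Hpos c ltac:(lra) Hc2) as Hp.
  pose proof (Hd c ltac:(lra)) as Hdc. apply is_derive_Reals in Hdc.
  (* With tolerance [Z' c] the difference quotient at [- h] is positive, whereas minimality makes it
     nonpositive. *)
  destruct (Hdc (Z' c) Hp) as [[e He] Hdel]; simpl in Hdel.
  set (h := Rmin (e / 2) (c / 2)).
  assert (Hh : 0 < h) by (apply Rmin_glb_lt; lra).
  assert (h <= e / 2) by apply Rmin_l. assert (h <= c / 2) by apply Rmin_r.
  specialize (Hdel (- h) ltac:(lra)). rewrite Rabs_Ropp Rabs_pos_eq in Hdel; [|lra].
  specialize (Hdel ltac:(lra)). apply Rabs_def2 in Hdel. destruct Hdel as [_ Hdel].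
  pose proof (Hc3 (c + - h) ltac:(lra)).
  assert ((Z (c + - h) - Z c) / - h <= 0); [|lra].
  replace ((Z (c + - h) - Z c) / - h) with (- ((Z (c + - h) - Z c) * / h)) by (field; lra).
  pose proof (Rinv_0_lt_compat _ Hh). nra.
Qed.

Definition ratio (x : R) := ellD x / ellB x.

Lemma ratio_pos x : x < 1 -> 0 < ratio x.
Proof. intros Hx. apply Rdiv_lt_0_compat. now apply ellD_pos. now apply ellB_pos. Qed.

Lemma ratio_0 : ratio 0 = 1.
Proof. unfold ratio. rewrite B0_eq_D0. field. pose proof (ellD_pos 0). lra. Qed.

(** Derived from differentiation under the integral rather than from the contiguity relations, which
    divide by [x]: continuity at [x = 0] is needed later. *)
Lemma ratio_ex_derive x : x < 1 -> ex_derive ratio x.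
Proof.
  intros Hx. apply ex_derive_div.
  - eexists. apply (weighted_int_derive _ sin2_continuous x Hx).
  - eexists. apply (weighted_int_derive _ cos2_continuous x Hx).
  - pose proof (ellB_pos x Hx). lra.
Qed.

Lemma ratio_derive x : 0 < x < 1 ->
  is_derive ratio x ((1 - (1 - x) * ratio x ^ 2) / (2 * x * (1 - x))).
Proof.
  intros Hx. pose proof (ellB_pos x ltac:(lra)).
  evar_last. { apply is_derive_div. now apply ellD_derive. now apply ellB_derive. lra. }
  unfold minus, plus, opp, ratio; simpl. field. lra.
Qed.

(** The line is the tangent of [ratio] at 0. Where [ratio] lies on or below it, the Riccati equation
    gives a slope above 1/4. The sharp slope is what later yields the limit 8/5. *)
Lemma ratio_lower x : 0 < x < 1 -> 1 + x / 4 < ratio x.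
Proof.
  intros Hx.
  enough (0 < ratio x - 1 - x / 4) by lra.
  apply (pos_of_derive_pos_when_nonpos (fun x => ratio x - 1 - x / 4)
    (fun x => (1 - (1 - x) * ratio x ^ 2) / (2 * x * (1 - x)) - / 4)); auto.
  - intros z Hz. apply (ex_derive_continuous (V := R_NormedModule)).
    pose proof (ratio_ex_derive z ltac:(lra)). auto_derive. auto.
  - rewrite ratio_0. lra.
  - intros z Hz. pose proof (ratio_derive z Hz) as Hr. auto_derive.
    + eexists; exact Hr.
    + rewrite (is_derive_unique _ _ _ Hr). field. lra.
  - intros z Hz Hle. pose proof (ratio_pos z ltac:(lra)) as Hp.
    set (r := ratio z) in *.
    replace (_ - / 4) with ((1 - (1 - z) * r ^ 2 - z * (1 - z) / 2) * / (2 * z * (1 - z))) by (field; lra).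
    apply Rmult_lt_0_compat; [|apply Rinv_0_lt_compat; nra].
    assert (r ^ 2 <= (1 + z / 4) ^ 2) by (apply pow_incr; lra).
    assert ((1 - z) * r ^ 2 <= (1 - z) * (1 + z / 4) ^ 2) by (apply Rmult_le_compat_l; lra).
    (* The remaining lower bound is [15 z^2 / 16 + z^3 / 16]. *)
    assert (0 < z ^ 2) by nra. assert (0 < z ^ 3) by (apply pow_lt; lra). nra.
Qed.

(* The numerator of the derivative of [2 / (1 - x) - (5 r^2 - 2 r - 1)] under the
   Riccati equation, with [y = 1 - x]. *)
Lemma upper_barrier_algebra r y : 1 < r -> 0 < y < 1 -> 2 <= y * (5 * r ^ 2 - 2 * r - 1) ->
  0 < 2 - y * (5 * r + 1) + y ^ 2 * (r ^ 2 * (5 * r - 1)).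
Proof.
  intros Hr Hy Hp.
  set (p := 5 * r ^ 2 - 2 * r - 1) in *. set (c := r ^ 2 * (5 * r - 1)).
  assert (Hp0 : 0 < p) by (unfold p; nra).
  assert (Hc0 : 0 < c) by (apply Rmult_lt_0_compat; nra).
  (* Near [r = 1] the quadratic in [y] takes negative values, so [y p >= 2] must be used; for
     [r > 6/5] its discriminant is negative. The polynomials [H1] of both cases are positive at
     6/5. *)
  destruct (Rle_dec r (6 / 5)) as [Hr2|Hr2].
  - assert (H1 : 0 <= 4 * c - p * (5 * r + 1)).
    { replace (4 * c - p * (5 * r + 1)) with (- 5 * r ^ 3 + r ^ 2 + 7 * r + 1) by (unfold c, p; ring).
      nra. }
    set (g := y * p - 2). assert (Hg : 0 <= g) by (unfold g; lra).
    apply Rmult_lt_reg_r with (p ^ 2); [now apply pow_lt|]. rewrite Rmult_0_l.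
    (* Expansion in powers of [g], with nonnegative coefficients; the constant term has a double
       zero at [r = 1]. *)
    replace (_ * p ^ 2) with (2 * (r - 1) ^ 2 * (25 * r ^ 2 + 15 * r + 2)
      + g * (4 * c - p * (5 * r + 1)) + g ^ 2 * c) by (unfold g, c, p; ring).
    assert (0 < 2 * (r - 1) ^ 2 * (25 * r ^ 2 + 15 * r + 2)).
    { apply Rmult_lt_0_compat; [|nra]. apply Rmult_lt_0_compat; [lra|]. apply pow_lt; lra. }
    assert (0 <= g * (4 * c - p * (5 * r + 1))) by (apply Rmult_le_pos; lra).
    assert (0 <= g ^ 2 * c) by (apply Rmult_le_pos; [apply pow2_ge_0|lra]). lra.
  - assert (H1 : 0 < 8 * c - (5 * r + 1) ^ 2).
    { replace (8 * c - (5 * r + 1) ^ 2) with (40 * r ^ 3 - 33 * r ^ 2 - 10 * r - 1) by (unfold c; ring).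
      nra. }
    apply Rmult_lt_reg_r with (8 * c); [lra|]. rewrite Rmult_0_l.
    replace (_ * (8 * c)) with (2 * (8 * c - (5 * r + 1) ^ 2) + 2 * (2 * c * y - (5 * r + 1)) ^ 2) by ring.
    pose proof (pow2_ge_0 (2 * c * y - (5 * r + 1))). lra.
Qed.

(** Dividing by [1 - x] gives a barrier function that vanishes at 0, since [5 r^2 - 2 r - 1 = 2] at
    [r = 1]. Where it is nonpositive, [upper_barrier_algebra] makes its derivative positive. *)
Lemma ratio_upper x : 0 < x < 1 -> (1 - x) * (5 * ratio x ^ 2 - 2 * ratio x - 1) < 2.
Proof.
  intros Hx.
  enough (H : 0 < 2 / (1 - x) - (5 * ratio x ^ 2 - 2 * ratio x - 1)).
  { assert (0 < (1 - x) * (2 / (1 - x) - (5 * ratio x ^ 2 - 2 * ratio x - 1))) as H1 by (apply Rmult_lt_0_compat; lra).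
    rewrite Rmult_minus_distr_l in H1. replace ((1 - x) * (2 / (1 - x))) with 2 in H1 by (field; lra). lra. }
  apply (pos_of_derive_pos_when_nonpos (fun x => 2 / (1 - x) - (5 * ratio x ^ 2 - 2 * ratio x - 1))
    (fun x => 2 / (1 - x) ^ 2 - (10 * ratio x - 2) * ((1 - (1 - x) * ratio x ^ 2) / (2 * x * (1 - x))))); auto.
  - intros z Hz. apply (ex_derive_continuous (V := R_NormedModule)).
    pose proof (ratio_ex_derive z ltac:(lra)). auto_derive. repeat split; auto. lra.
  - rewrite ratio_0. field.
  - intros z Hz. pose proof (ratio_derive z Hz) as Hr. auto_derive.
    + assert (ex_derive ratio z) by (eexists; exact Hr). repeat split; auto. lra.
    + rewrite (is_derive_unique _ _ _ Hr). simpl. field. lra.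
  - intros z Hz Hle. pose proof (ratio_lower z Hz) as Hp.
    set (r := ratio z) in *.
    replace (2 / _ ^ 2 - _) with ((2 - (1 - z) * (5 * r + 1) + (1 - z) ^ 2 * (r ^ 2 * (5 * r - 1))) * / (z * (1 - z) ^ 2)) by (field; lra).
    apply Rmult_lt_0_compat; [|apply Rinv_0_lt_compat; apply Rmult_lt_0_compat; [lra|apply pow_lt; lra]].
    apply upper_barrier_algebra; try lra.
    replace 2 with ((1 - z) * (2 / (1 - z))) at 1 by (field; lra).
    apply Rmult_le_compat_l; lra.
Qed.

(** * The threshold function: monotonicity and two-sided bounds *)

(** With [r = ratio x], the value of the numerator [a - log (1 - x) / 2] at which the second
    derivative of [F a] vanishes; [threshold] is the corresponding [a]. *)
Definition critical (x r : R) := 2 * x * r * (1 + r) / (2 * x * r + (1 - x) * (r ^ 2 - 1)).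
Definition threshold (x : R) := critical x (ratio x) + / 2 * ln (1 - x).

Lemma critical_denom_pos x r : 0 < x < 1 -> 1 < r -> 0 < 2 * x * r + (1 - x) * (r ^ 2 - 1).
Proof. intros. assert (0 < r ^ 2 - 1) by nra. nra. Qed.

Lemma threshold_derive x : 0 < x < 1 ->
  is_derive threshold x (- (1 + ratio x) ^ 2 * (2 - (1 - x) * (5 * ratio x ^ 2 - 2 * ratio x - 1))
     / (2 * (2 * x * ratio x + (1 - x) * (ratio x ^ 2 - 1)) ^ 2)).
Proof.
  intros Hx. pose proof (ratio_lower x Hx). pose proof (critical_denom_pos x (ratio x) Hx ltac:(lra)).
  pose proof (ratio_derive x Hx) as Hr. unfold threshold, critical. auto_derive.
  - assert (ex_derive ratio x) by (eexists; exact Hr). simpl in *. repeat split; auto; lra.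
  - rewrite (is_derive_unique _ _ _ Hr). simpl in *. field. lra.
Qed.

Lemma threshold_decr x z : 0 < x -> x < z -> z < 1 -> threshold z < threshold x.
Proof.
  intros Hx Hxz Hz. enough (- threshold x < - threshold z) by lra.
  apply (incr_function (fun x => - threshold x) 0 1 (fun x => - (- (1 + ratio x) ^ 2 * (2 - (1 - x) * (5 * ratio x ^ 2 - 2 * ratio x - 1))
     / (2 * (2 * x * ratio x + (1 - x) * (ratio x ^ 2 - 1)) ^ 2)))); simpl; auto.
  - intros u Hu1 Hu2. apply (is_derive_opp threshold). apply threshold_derive. lra.
  - intros u Hu1 Hu2. pose proof (ratio_lower u ltac:(lra)). pose proof (ratio_upper u ltac:(lra)).
    pose proof (critical_denom_pos u (ratio u) ltac:(lra) ltac:(lra)) as Hd.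
    set (d := 2 * u * ratio u + _) in *. set (e := (1 - u) * _) in *. set (r := ratio u) in *.
    apply Rlt_gt.
    replace (- _) with ((1 + r) ^ 2 * (2 - e) / (2 * d ^ 2)) by (simpl; unfold d; field; apply Rgt_not_eq; exact Hd).
    apply Rdiv_lt_0_compat. apply Rmult_lt_0_compat; [apply pow_lt|]; lra.
    apply Rmult_lt_0_compat; [|apply pow_lt]; lra.
Qed.

(** [critical] is of the form 0/0 at [x = 0], [r = 1]. After division by [x], [ratio_upper] bounds
    [(1 - x) (r^2 - 1) / x], using [5 r^2 - 2 r - 3 = (r - 1) (5 r + 3)]. The resulting bound is
    continuous at 0 with value 8/5. *)
Lemma threshold_lower_bound x : 0 < x < 1 ->
  2 * ratio x * (1 + ratio x) / (2 * ratio x + 2 * (ratio x + 1) / (5 * ratio x + 3)) + / 2 * ln (1 - x) <= threshold x.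
Proof.
  intros Hx. apply Rplus_le_compat_r. unfold critical.
  pose proof (ratio_lower x Hx). pose proof (ratio_upper x Hx) as Hu.
  set (r := ratio x) in *.
  pose proof (critical_denom_pos x r Hx ltac:(lra)).
  replace (2 * x * r * (1 + r) / (2 * x * r + (1 - x) * (r ^ 2 - 1)))
    with (2 * r * (1 + r) * / (2 * r + (1 - x) * (r ^ 2 - 1) / x)) by (field; lra).
  apply Rmult_le_compat_l. { apply Rmult_le_pos; lra. }
  apply Rinv_le_contravar.
  - assert (0 < (1 - x) * (r ^ 2 - 1) / x); [|lra]. apply Rdiv_lt_0_compat; [|lra]. apply Rmult_lt_0_compat; nra.
  - apply Rplus_le_compat_l. apply (Rle_div_l _ _ x); [lra|].
    replace (2 * (r + 1) / (5 * r + 3) * x) with (2 * (r + 1) * x / (5 * r + 3)) by (field; lra).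
    apply (Rle_div_r _ _ (5 * r + 3)); [lra|].
    replace ((1 - x) * (r ^ 2 - 1) * (5 * r + 3)) with ((r + 1) * ((1 - x) * (5 * r ^ 2 - 2 * r - 1) - 2 * (1 - x))) by ring.
    replace (2 * (r + 1) * x) with ((r + 1) * (2 * x)) by ring.
    apply Rmult_le_compat_l; lra.
Qed.

(** The counterpart from [r - 1 > x / 4], with the same value 8/5 at 0. *)
Lemma threshold_upper_bound x : 0 < x < 1 ->
  threshold x <= 2 * ratio x * (1 + ratio x) / (2 * ratio x + (1 - x) * (ratio x + 1) / 4) + / 2 * ln (1 - x).
Proof.
  intros Hx. apply Rplus_le_compat_r. unfold critical.
  pose proof (ratio_lower x Hx) as Hl.
  set (r := ratio x) in *.
  pose proof (critical_denom_pos x r Hx ltac:(lra)).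
  replace (2 * x * r * (1 + r) / (2 * x * r + (1 - x) * (r ^ 2 - 1)))
    with (2 * r * (1 + r) * / (2 * r + (1 - x) * (r ^ 2 - 1) / x)) by (field; lra).
  apply Rmult_le_compat_l. { apply Rmult_le_pos; lra. }
  assert (0 < (1 - x) * (r + 1)) by (apply Rmult_lt_0_compat; lra).
  apply Rinv_le_contravar.
  - lra.
  - apply Rplus_le_compat_l. apply (Rle_div_r _ _ x); [lra|].
    replace ((1 - x) * (r + 1) / 4 * x) with ((1 - x) * (r + 1) * (x / 4)) by field.
    replace ((1 - x) * (r ^ 2 - 1)) with ((1 - x) * (r + 1) * (r - 1)) by ring.
    apply Rmult_le_compat_l; lra.
Qed.

(** * The limit 8/5 of the threshold at 0 *)

Lemma locally_0_elim (P : R -> Prop) : locally 0 P -> exists d, 0 < d < 1 /\ forall x, 0 < x < d -> P x.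
Proof.
  intros [e He]. exists (Rmin e (/ 2)).
  pose proof (cond_pos e). pose proof (Rmin_l e (/ 2)). pose proof (Rmin_r e (/ 2)).
  split. { split; [apply Rmin_glb_lt|]; lra. }
  intros x Hx. apply He. unfold ball; simpl; unfold AbsRing_ball, abs, minus, plus, opp; simpl.
  rewrite Ropp_0 Rplus_0_r Rabs_pos_eq; lra.
Qed.

Lemma threshold_near_0 a : a < 8 / 5 -> exists d, 0 < d < 1 /\ forall x, 0 < x < d -> a < threshold x.
Proof.
  intros Ha.
  set (g := fun x => 2 * ratio x * (1 + ratio x) / (2 * ratio x + 2 * (ratio x + 1) / (5 * ratio x + 3)) + / 2 * ln (1 - x)).
  assert (Hg : continuous g 0).
  { apply (ex_derive_continuous (V := R_NormedModule)). unfold g.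
    pose proof (ratio_ex_derive 0 ltac:(lra)). auto_derive. rewrite ratio_0. repeat split; auto; lra. }
  assert (Hg0 : a < g 0).
  { unfold g. rewrite ratio_0 Rminus_0_r ln_1. lra. }
  destruct (locally_0_elim _ (Hg _ (open_gt a (g 0) Hg0))) as [d [Hd1 Hd2]].
  exists d. split; auto. intros x Hx. apply Rlt_le_trans with (g x); auto.
  apply (threshold_lower_bound x). lra.
Qed.

(** If the value at [x] were at least 8/5, the value at [x / 2] would exceed 8/5 strictly;
    monotonicity keeps this margin down to 0, where the upper bound tends to 8/5. *)
Lemma threshold_lt x : 0 < x < 1 -> threshold x < 8 / 5.
Proof.
  intros Hx. apply Rnot_le_lt. intros Hle.
  set (g := fun x => 2 * ratio x * (1 + ratio x) / (2 * ratio x + (1 - x) * (ratio x + 1) / 4) + / 2 * ln (1 - x)).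
  assert (Hg : continuous g 0).
  { apply (ex_derive_continuous (V := R_NormedModule)). unfold g.
    pose proof (ratio_ex_derive 0 ltac:(lra)). auto_derive. rewrite ratio_0. repeat split; auto; lra. }
  pose proof (threshold_decr (x / 2) x ltac:(lra) ltac:(lra) ltac:(lra)) as H1.
  assert (Hg0 : g 0 < threshold (x / 2)).
  { unfold g. rewrite ratio_0 Rminus_0_r ln_1. lra. }
  destruct (locally_0_elim _ (Hg _ (open_lt _ (g 0) Hg0))) as [d [Hd1 Hd2]].
  set (z := Rmin d (x / 2) / 2).
  pose proof (Rmin_l d (x / 2)). pose proof (Rmin_r d (x / 2)).
  assert (0 < Rmin d (x / 2)) by (apply Rmin_glb_lt; lra).
  pose proof (Hd2 z ltac:(unfold z; lra)).
  pose proof (threshold_decr z (x / 2) ltac:(unfold z; lra) ltac:(unfold z; lra) ltac:(lra)).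
  pose proof (threshold_upper_bound z ltac:(unfold z; lra)) as H5. fold (g z) in H5. lra.
Qed.

(** * The limit log 4 of the threshold at 1 *)

Lemma ln_le_sub_1 u : 0 < u -> ln u <= u - 1.
Proof.
  intros Hu. rewrite -(ln_exp (u - 1)). apply ln_le; auto.
  pose proof (exp_ineq1_le (u - 1)). lra.
Qed.

Lemma ln_2_bounds : 0 < ln 2 <= 1.
Proof. split. rewrite -ln_1. apply ln_increasing; lra. pose proof (ln_le_sub_1 2). lra. Qed.

Lemma ln_4 : ln 4 = 2 * ln 2.
Proof. replace 4 with (2 * 2) by ring. rewrite ln_mult; lra. Qed.

(* With [x = 1 - s^4], the error terms in [sqrt (1 - x) * ln (1 - x)] become [O(s)]. *)
Lemma K_asymptotic s : 0 < s <= 1 / 2 ->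
  Rabs (K (1 - s ^ 4) - (ln 4 - 2 * ln s)) <= 12 * s.
Proof.
  intros Hs. set (x := 1 - s ^ 4).
  assert (Hs2 : s ^ 2 <= / 4) by nra. assert (Hs20 : 0 < s ^ 2) by nra.
  assert (Hs4 : 0 < s ^ 4 <= / 16) by (replace (s ^ 4) with (s ^ 2 * s ^ 2) by ring; nra).
  assert (Hx : 0 < x < 1) by (unfold x; lra).
  assert (Hq : sqrt (1 - x) = s ^ 2).
  { unfold x. replace (1 - (1 - s ^ 4)) with ((s ^ 2) ^ 2) by ring. apply sqrt_pow2. lra. }
  pose proof (K_bounds x Hx) as HK. unfold log_part in HK. rewrite Hq in HK.
  assert (Hls : ln (s ^ 2) = 2 * ln s) by (rewrite -(Rpower_pow 2 s) ?ln_Rpower; simpl; lra).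
  rewrite Hls in HK.
  (* This crude bound suffices, since in the error the logarithm comes with a factor [s^4]. *)
  assert (Hl : 0 <= - ln s <= / s).
  { split.
    - pose proof (ln_le_sub_1 s). lra.
    - rewrite -ln_Rinv; [|lra]. pose proof (ln_le_sub_1 (/ s) ltac:(apply Rinv_0_lt_compat; lra)). lra. }
  assert (Hk : / 2 <= sqrt x <= 1).
  { split. rewrite -(sqrt_pow2 (/ 2)); [|lra]. apply sqrt_le_1_alt. unfold x. lra.
    rewrite -sqrt_1. apply sqrt_le_1_alt. lra. }
  assert (Hk2 : sqrt x * sqrt x = x) by (apply sqrt_sqrt; lra).
  set (k := sqrt x) in *. set (l := - ln s) in *.
  pose proof ln_2_bounds as H2.
  assert (H1k : 1 - k <= s ^ 4) by (unfold x in Hk2; nra).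
  assert (Hinv : 1 <= / k <= 1 + 2 * s ^ 4).
  { split. rewrite -{1}Rinv_1. apply Rinv_le_contravar; lra.
    apply Rmult_le_reg_r with k; [lra|]. rewrite Rinv_l; [|lra]. nra. }
  assert (Hlk : ln 2 - s ^ 4 <= ln (1 + k) <= ln 2).
  { split; [|apply ln_le; lra].
    pose proof (ln_le_sub_1 (2 / (1 + k)) ltac:(apply Rdiv_lt_0_compat; lra)) as H.
    rewrite ln_div in H; try lra.
    assert (2 / (1 + k) <= 1 + s ^ 4); [|lra].
    apply Rmult_le_reg_r with (1 + k); [lra|]. replace (2 / (1 + k) * (1 + k)) with 2 by (field; lra). nra. }
  pose proof PI_4. pose proof PI_RGT_0.
  assert (Hls4 : l * s ^ 4 <= s ^ 3).
  { replace (s ^ 3) with (/ s * s ^ 4) by (field; lra). apply Rmult_le_compat_r; lra. }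
  assert (Hs3 : s ^ 3 <= s) by (replace (s ^ 3) with (s * s ^ 2) by ring; nra).
  assert (Hs4s : s ^ 4 <= s) by (replace (s ^ 4) with (s * s ^ 3) by ring; nra).
  assert (Hs2s : s ^ 2 <= s) by nra.
  unfold Rdiv in HK. rewrite ln_4.
  replace (ln (1 + k) - 2 * ln s) with (ln (1 + k) + 2 * l) in HK by (unfold l; ring).
  set (m := ln (1 + k)) in *.
  assert (Hm : 0 <= m) by (rewrite -ln_1; apply ln_le; lra).
  set (M := m + 2 * l) in *.
  assert (HM : 0 <= M) by (unfold M; lra).
  assert (M <= M * / k <= M + 2 * (M * s ^ 4)).
  { pose proof (Rmult_le_compat_l M _ _ HM (proj1 Hinv)).
    pose proof (Rmult_le_compat_l M _ _ HM (proj2 Hinv)). lra. }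
  assert (M * s ^ 4 <= 3 * s).
  { assert (m * s ^ 4 <= 1 * s ^ 4) by (apply Rmult_le_compat_r; lra). unfold M. lra. }
  assert (PI * / 2 * s ^ 2 <= 2 * s) by nra.
  replace (2 * ln s) with (- 2 * l) by (unfold l; ring).
  apply Rabs_le. unfold M in *. lra.
Qed.

(** [critical] equals [K / (B (1 + w))], where [B - 1] and [w] are small enough to outweigh the
    growth [K = O(1/s)]. So [threshold] is [K + 2 log s] up to [O(s)], which tends to log 4. *)
Lemma threshold_near_1 s : 0 < s <= 1 / 2 -> Rabs (threshold (1 - s ^ 4) - ln 4) <= 600 * s.
Proof.
  intros Hs. pose proof (K_asymptotic s Hs) as HK.
  set (x := 1 - s ^ 4) in *.
  assert (Hs2 : s ^ 2 <= / 4) by nra. assert (Hs20 : 0 < s ^ 2) by nra.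
  assert (Hs4 : 0 < s ^ 4 <= / 16) by (replace (s ^ 4) with (s ^ 2 * s ^ 2) by ring; nra).
  assert (Hx : 0 < x < 1) by (unfold x; lra).
  assert (Hq : sqrt (1 - x) = s ^ 2).
  { unfold x. replace (1 - (1 - s ^ 4)) with ((s ^ 2) ^ 2) by ring. apply sqrt_pow2. lra. }
  pose proof (ellB_bounds x Hx) as HB. rewrite Hq in HB.
  pose proof PI_4 as Hpi4. pose proof PI_RGT_0 as Hpi.
  assert (Hl : 0 <= - ln s <= / s).
  { split.
    - pose proof (ln_le_sub_1 s). lra.
    - rewrite -ln_Rinv; [|lra]. pose proof (ln_le_sub_1 (/ s) ltac:(apply Rinv_0_lt_compat; lra)). lra. }
  assert (HKs : 0 < K x /\ K x * s <= 7).
  { assert (Hsi : / s * s = 1) by (field; lra). pose proof ln_2_bounds. rewrite ln_4 in HK.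
    apply Rabs_le_between in HK. split.
    - rewrite K_ellBD; [|lra]. pose proof (ellB_pos x ltac:(lra)). pose proof (ellD_pos x ltac:(lra)). lra.
    - nra. }
  pose proof (ellB_pos x ltac:(lra)) as Hb0.
  destruct HKs as [HK0 HKs].
  assert (HLn : / 2 * ln (1 - x) = 2 * ln s).
  { unfold x. replace (1 - (1 - s ^ 4)) with (s ^ 4) by ring.
    rewrite -(Rpower_pow 4 s) ?ln_Rpower; simpl; lra. }
  pose proof (ratio_lower x Hx) as Hr.
  assert (HrK : (1 + ratio x) * ellB x = K x).
  { rewrite K_ellBD; [|lra]. unfold ratio. field. lra. }
  unfold threshold. rewrite HLn. unfold critical.
  set (r := ratio x) in *. set (b := ellB x) in *.
  assert (Hb2 : 1 - 2 * s ^ 2 <= b).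
  { pose proof (Rmult_le_compat_r (s ^ 2) (PI / 2) 2 ltac:(lra) ltac:(lra)). lra. }
  assert (Hb : 1 / 2 <= b) by lra.
  (* The second term of the denominator of [critical] relative to the first. *)
  set (w := (1 - x) * (r ^ 2 - 1) / (2 * x * r)).
  assert (Hw : 0 <= w <= 2 * s ^ 4 * K x).
  { unfold w. replace (1 - x) with (s ^ 4) by (unfold x; ring). split.
    - apply Rmult_le_pos.
      + apply Rmult_le_pos; [lra|]. pose proof (pow_R1_Rle r 2 ltac:(lra)). lra.
      + apply Rlt_le, Rinv_0_lt_compat. apply Rmult_lt_0_compat; lra.
    - assert (Hxr : 0 < 2 * x * r) by (apply Rmult_lt_0_compat; lra).
      apply (Rle_div_l _ _ (2 * x * r) Hxr).
      assert (Hr2 : r <= 2 * K x) by nra. assert (Hx2 : 1 <= 2 * x) by (unfold x; lra).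
      assert (HKr : 0 <= 2 * K x * r) by (apply Rmult_le_pos; lra).
      replace (2 * s ^ 4 * K x * (2 * x * r)) with (s ^ 4 * (2 * K x * r * (2 * x))) by ring.
      apply Rmult_le_compat_l; [lra|].
      pose proof (Rmult_le_compat_r r _ _ ltac:(lra) Hr2).
      pose proof (Rmult_le_compat_l _ _ _ HKr Hx2). simpl. lra. }
  assert (E : 2 * x * r * (1 + r) / (2 * x * r + (1 - x) * (r ^ 2 - 1)) = K x / (b * (1 + w))).
  { rewrite -HrK. unfold w. pose proof (critical_denom_pos x r Hx ltac:(lra)). field.
    repeat split; lra. }
  rewrite E.
  assert (Hbw : 1 / 2 <= b * (1 + w)).
  { pose proof (Rmult_le_pos b w ltac:(lra) ltac:(lra)). lra. }
  assert (Hs3 : s ^ 3 <= s) by (replace (s ^ 3) with (s * s ^ 2) by ring; nra).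
  assert (Herr : Rabs (K x / (b * (1 + w)) - K x) <= 500 * s).
  { replace (K x / (b * (1 + w)) - K x) with (K x * (1 - b * (1 + w)) * / (b * (1 + w))) by (field; lra).
    assert (Hi : 0 < / (b * (1 + w)) <= 2).
    { split. apply Rinv_0_lt_compat; lra. replace 2 with (/ (1 / 2)) by field. apply Rinv_le_contravar; lra. }
    assert (H1 : Rabs (1 - b * (1 + w)) <= 2 * s ^ 2 + w).
    { assert (b * w <= w) by (rewrite -{2}(Rmult_1_l w); apply Rmult_le_compat_r; lra).
      assert (0 <= b * w) by (apply Rmult_le_pos; lra).
      apply Rabs_le. lra. }
    rewrite !Rabs_mult (Rabs_pos_eq (K x)) ?(Rabs_pos_eq (/ _)); try lra.
    assert (H2 : K x * Rabs (1 - b * (1 + w)) <= K x * (2 * s ^ 2 + w)) by (apply Rmult_le_compat_l; lra).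
    assert (H3 : K x * s * s <= 7 * s) by (apply Rmult_le_compat_r; lra).
    (* [K w <= 2 s^2 (K s)^2] and [98 = 2 * 7^2]. *)
    assert (H4 : K x * w <= 98 * s).
    { assert (K x * w <= K x * (2 * s ^ 4 * K x)) by (apply Rmult_le_compat_l; lra).
      assert ((K x * s) ^ 2 <= 7 ^ 2).
      { apply pow_incr. split; [|lra]. apply Rmult_le_pos; lra. }
      assert (s ^ 2 * (K x * s) ^ 2 <= s ^ 2 * 7 ^ 2) by (apply Rmult_le_compat_l; lra).
      replace (K x * (2 * s ^ 4 * K x)) with (2 * (s ^ 2 * (K x * s) ^ 2)) in H0 by ring.
      assert (s ^ 2 <= s) by nra. lra. }
    replace (500 * s) with (250 * s * 2) by ring.
    apply Rmult_le_compat; try lra. apply Rmult_le_pos; [lra|apply Rabs_pos]. }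
  apply Rabs_le_between in Herr. apply Rabs_le_between in HK. apply Rabs_le. lra.
Qed.

Lemma near_1_exists e x : 0 < e -> x < 1 -> exists s, 0 < s <= 1 / 2 /\ x < 1 - s ^ 4 /\ 600 * s < e.
Proof.
  intros He Hx. set (s := Rmin (1 / 2) (Rmin (e / 1200) ((1 - x) / 2))).
  assert (0 < s) by (repeat apply Rmin_glb_lt; lra).
  assert (s <= 1 / 2) by apply Rmin_l.
  assert (s <= Rmin (e / 1200) ((1 - x) / 2)) by apply Rmin_r.
  pose proof (Rmin_l (e / 1200) ((1 - x) / 2)). pose proof (Rmin_r (e / 1200) ((1 - x) / 2)).
  exists s. repeat split; try lra.
  assert (s ^ 4 <= s).
  { assert (0 <= s ^ 3 <= 1). { split. apply pow_le; lra. rewrite -(pow1 3). apply pow_incr; lra. }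
    replace (s ^ 4) with (s * s ^ 3) by ring. nra. }
  lra.
Qed.

(** As at 0: passing to the midpoint of [x] and 1 gains a strict margin below log 4, which
    contradicts the limit at 1. *)
Lemma threshold_gt x : 0 < x < 1 -> ln 4 < threshold x.
Proof.
  intros Hx. apply Rnot_le_lt. intros Hle.
  pose proof (threshold_decr x ((1 + x) / 2) ltac:(lra) ltac:(lra) ltac:(lra)).
  destruct (near_1_exists (ln 4 - threshold ((1 + x) / 2)) ((1 + x) / 2)) as [s [Hs [Hs1 Hs2]]]; try lra.
  pose proof (threshold_near_1 s Hs) as Hn. apply Rabs_le_between in Hn.
  assert (0 < s ^ 4) by (apply pow_lt; lra).
  pose proof (threshold_decr ((1 + x) / 2) (1 - s ^ 4) ltac:(lra) ltac:(lra) ltac:(lra)). lra.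
Qed.

Lemma threshold_near_1_lt a : ln 4 < a -> exists d, 0 < d < 1 /\ forall x, d < x < 1 -> threshold x < a.
Proof.
  intros Ha. destruct (near_1_exists (a - ln 4) 0) as [s [Hs [Hs1 Hs2]]]; try lra.
  pose proof (threshold_near_1 s Hs) as Hn. apply Rabs_le_between in Hn.
  assert (0 < s ^ 4) by (apply pow_lt; lra).
  exists (1 - s ^ 4). split; [lra|]. intros x Hx.
  pose proof (threshold_decr (1 - s ^ 4) x ltac:(lra) ltac:(lra) ltac:(lra)). lra.
Qed.

(** * Strict convexity and concavity from the second derivative *)

Lemma strictly_convex_of_derive2 (f f1 f2 : R -> R) l u :
  (forall x, l < x < u -> is_derive f x (f1 x)) ->
  (forall x, l < x < u -> is_derive f1 x (f2 x)) ->
  (forall x, l < x < u -> 0 < f2 x) ->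
  strictly_convex_on f l u.
Proof.
  intros Hf Hf1 Hf2.
  assert (Hlt : forall x y t, l < x -> x < y -> y < u -> 0 < t < 1 ->
    f (t * x + (1 - t) * y) < t * f x + (1 - t) * f y).
  { intros x y t Hx Hxy Hy Ht. set (z := t * x + (1 - t) * y).
    assert (Hz1 : z - x = (1 - t) * (y - x)) by (unfold z; ring).
    assert (Hz2 : y - z = t * (y - x)) by (unfold z; ring).
    assert (0 < (1 - t) * (y - x)) by (apply Rmult_lt_0_compat; lra).
    assert (0 < t * (y - x)) by (apply Rmult_lt_0_compat; lra).
    (* Mean values of [f1] on each side of [z], then of [f2] between them, show that the right slope
       exceeds the left one. *)
    destruct (MVT_cor2 f f1 x z) as [c1 [E1 Hc1]]; [lra| |].
    { intros c Hc. apply is_derive_Reals, Hf. lra. }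
    destruct (MVT_cor2 f f1 z y) as [c2 [E2 Hc2]]; [lra| |].
    { intros c Hc. apply is_derive_Reals, Hf. lra. }
    destruct (MVT_cor2 f1 f2 c1 c2) as [c3 [E3 Hc3]]; [lra| |].
    { intros c Hc. apply is_derive_Reals, Hf1. lra. }
    pose proof (Hf2 c3 ltac:(lra)) as Hp.
    assert (0 < f2 c3 * (c2 - c1)) by (apply Rmult_lt_0_compat; lra).
    rewrite Hz1 in E1. rewrite Hz2 in E2.
    assert (E : t * f x + (1 - t) * f y - f z = t * ((1 - t) * (y - x)) * (f1 c2 - f1 c1)).
    { replace (t * f x + (1 - t) * f y - f z) with ((1 - t) * (f y - f z) - t * (f z - f x)) by ring.
      rewrite E1 E2. ring. }
    assert (0 < t * ((1 - t) * (y - x)) * (f1 c2 - f1 c1)); [|lra].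
    apply Rmult_lt_0_compat; [apply Rmult_lt_0_compat|]; lra. }
  intros x y t Hx Hy Hxy Ht. destruct (Rtotal_order x y) as [H|[H|H]]; [|easy|].
  - apply Hlt; lra.
  - replace (t * x + (1 - t) * y) with ((1 - t) * y + (1 - (1 - t)) * x) by ring.
    replace (t * f x + (1 - t) * f y) with ((1 - t) * f y + (1 - (1 - t)) * f x) by ring.
    apply Hlt; lra.
Qed.

Lemma strictly_concave_of_derive2 (f f1 f2 : R -> R) l u :
  (forall x, l < x < u -> is_derive f x (f1 x)) ->
  (forall x, l < x < u -> is_derive f1 x (f2 x)) ->
  (forall x, l < x < u -> f2 x < 0) ->
  strictly_concave_on f l u.
Proof.
  intros Hf Hf1 Hf2.
  assert (Hc : strictly_convex_on (fun x => - f x) l u).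
  { apply (strictly_convex_of_derive2 _ (fun x => - f1 x) (fun x => - f2 x)).
    - intros x Hx. apply (is_derive_opp f), Hf, Hx.
    - intros x Hx. apply (is_derive_opp f1), Hf1, Hx.
    - intros x Hx. specialize (Hf2 x Hx). lra. }
  intros x y t Hx Hy Hxy Ht. specialize (Hc x y t Hx Hy Hxy Ht). simpl in Hc. lra.
Qed.

(** Serves the necessity directions: the wrong behaviour on a subinterval at one end refutes the
    global claim. *)
Lemma not_convex_and_concave (f : R -> R) l u l' u' : l < u -> l' <= l -> u <= u' ->
  strictly_convex_on f l' u' -> strictly_concave_on f l u -> False.
Proof.
  intros Hlu Hl Hu Hv Hc.
  specialize (Hv (l + (u - l) / 3) (l + (u - l) / 2) (1 / 2) ltac:(lra) ltac:(lra) ltac:(lra) ltac:(lra)).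
  specialize (Hc (l + (u - l) / 3) (l + (u - l) / 2) (1 / 2) ltac:(lra) ltac:(lra) ltac:(lra) ltac:(lra)).
  lra.
Qed.

(** * The derivatives of F and the two equivalences *)

(** The first derivative of [F a], simplified by [K' = B / (2 (1 - x))]. *)
Definition F1 a x :=
  (ellB x + ellD x - (a - / 2 * ln (1 - x)) * ellB x) / (2 * (1 - x) * (ellB x + ellD x) ^ 2).

(** The positive multiplier of [threshold x - a] in the second derivative; its numerator is [B^2]
    times the denominator of [critical] at [r = D / B]. *)
Definition F2_factor x :=
  (2 * x * ellB x * ellD x + (1 - x) * (ellD x ^ 2 - ellB x ^ 2))
  / (4 * x * (1 - x) ^ 2 * (ellB x + ellD x) ^ 3).

Lemma F_derive a x : 0 < x < 1 -> is_derive (F a) x (F1 a x).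
Proof.
  intros Hx. pose proof (ellB_derive x Hx) as HB. pose proof (ellD_derive x Hx) as HD.
  pose proof (ellB_pos x ltac:(lra)). pose proof (ellD_pos x ltac:(lra)).
  apply (is_derive_ext_loc (fun x => (a - / 2 * ln (1 - x)) / (ellB x + ellD x))).
  - assert (Hl : locally x (fun u => u < 1)) by (apply (open_lt 1); lra).
    apply: filter_imp Hl => u Hu. unfold F. now rewrite K_ellBD.
  - auto_derive.
    + assert (ex_derive ellB x) by (eexists; exact HB). assert (ex_derive ellD x) by (eexists; exact HD).
      repeat split; auto; lra.
    + rewrite (is_derive_unique _ _ _ HB) (is_derive_unique _ _ _ HD). unfold F1.
      change (1 + - x) with (1 - x). field. lra.
Qed.

Lemma F1_derive a x : 0 < x < 1 -> is_derive (F1 a) x (F2_factor x * (threshold x - a)).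
Proof.
  intros Hx. pose proof (ellB_derive x Hx) as HB. pose proof (ellD_derive x Hx) as HD.
  pose proof (ellB_pos x ltac:(lra)) as HB0. pose proof (ellD_pos x ltac:(lra)) as HD0.
  pose proof (ratio_lower x Hx) as Hr.
  pose proof (critical_denom_pos x (ratio x) Hx ltac:(lra)) as Hd.
  unfold F1. auto_derive.
  - assert (ex_derive ellB x) by (eexists; exact HB). assert (ex_derive ellD x) by (eexists; exact HD).
    simpl. repeat split; auto; try lra. apply Rgt_not_eq. repeat apply Rmult_lt_0_compat; lra.
  - rewrite (is_derive_unique _ _ _ HB) (is_derive_unique _ _ _ HD).
    change (1 + - x) with (1 - x). unfold F2_factor, threshold, critical.
    assert (HDr : ellD x = ratio x * ellB x) by (unfold ratio; field; lra). rewrite HDr.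
    field. repeat split; nra.
Qed.

Lemma F2_factor_pos x : 0 < x < 1 -> 0 < F2_factor x.
Proof.
  intros Hx. pose proof (ellB_pos x ltac:(lra)) as HB0. pose proof (ellD_pos x ltac:(lra)) as HD0.
  pose proof (ratio_lower x Hx) as Hr.
  assert (ellB x < ellD x).
  { assert (HDr : ellD x = ratio x * ellB x) by (unfold ratio; field; lra). nra. }
  apply Rdiv_lt_0_compat.
  - assert (0 < x * ellB x * ellD x) by (repeat apply Rmult_lt_0_compat; lra).
    assert (0 < ellD x ^ 2 - ellB x ^ 2) by nra. nra.
  - repeat apply Rmult_lt_0_compat; try apply pow_lt; lra.
Qed.

Lemma F_strictly_convex a l u : 0 <= l -> u <= 1 -> (forall x, l < x < u -> a < threshold x) ->
  strictly_convex_on (F a) l u.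
Proof.
  intros Hl Hu HL. apply (strictly_convex_of_derive2 _ (F1 a) (fun x => F2_factor x * (threshold x - a))).
  - intros x Hx. apply F_derive. lra.
  - intros x Hx. apply F1_derive. lra.
  - intros x Hx. specialize (HL x Hx). pose proof (F2_factor_pos x ltac:(lra)). nra.
Qed.

Lemma F_strictly_concave a l u : 0 <= l -> u <= 1 -> (forall x, l < x < u -> threshold x < a) ->
  strictly_concave_on (F a) l u.
Proof.
  intros Hl Hu HL. apply (strictly_concave_of_derive2 _ (F1 a) (fun x => F2_factor x * (threshold x - a))).
  - intros x Hx. apply F_derive. lra.
  - intros x Hx. apply F1_derive. lra.
  - intros x Hx. specialize (HL x Hx). pose proof (F2_factor_pos x ltac:(lra)). nra.
Qed.

Theorem theorem2 (a : R) :
  (strictly_convex_on (F a) 0 1 <-> a <= ln 4) /\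
  (strictly_concave_on (F a) 0 1 <-> 8 / 5 <= a).
Proof.
  split; split; intros Ha.
  (* For [a > log 4] the threshold drops below [a] near 1, so [F a] is strictly concave there. *)
  - apply Rnot_lt_le. intros Hlt. destruct (threshold_near_1_lt a Hlt) as [d [Hd HL]].
    apply (not_convex_and_concave (F a) d 1 0 1); auto; try lra.
    apply F_strictly_concave; auto; lra.
  - apply F_strictly_convex; try lra. intros x Hx. pose proof (threshold_gt x Hx). lra.
  (* For [a < 8/5] the threshold exceeds [a] near 0, so [F a] is strictly convex there. *)
  - apply Rnot_lt_le. intros Hlt. destruct (threshold_near_0 a Hlt) as [d [Hd HL]].
    apply (not_convex_and_concave (F a) 0 d 0 d); try lra.
    + apply F_strictly_convex; auto; lra.
    + intros x y t Hx Hy. apply Ha; lra.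
  - apply F_strictly_concave; try lra. intros x Hx. pose proof (threshold_lt x Hx). lra.
Qed.
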